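(* Let $A$ be a unital algebra over $\mathbb C$ and let $\Delta:A\to A\otimes A$ be a coproduct on $A$. If there exist a left faithful left integral and a right faithful right integral on $A$, then $A$ (with the coproduct $\Delta$) is a Hopf algebra. If these integrals are faithful, then $A$ has an invertible antipode.
   Context: Algebras are associative over $\mathbb C$, $\otimes$ is the algebraic tensor product, $\iota$ is the identity map. Here a coproduct on the unital algebra $A$ is an algebra homomorphism $\Delta:A\to A\otimes A$ satisfying $(\Delta\otimes\iota)\Delta=(\iota\otimes\Delta)\Delta$; it is not assumed that $\Delta(1)=1\otimes 1$, nor that a counit exists. A left integral is a non-zero linear functional $\varphi$ on $A$ with $(\iota\otimes\varphi)\Delta(a)=\varphi(a)1$ for all $a\in A$. A right integral is a non-zero linear functional $\psi$ on $A$ with $(\psi\otimes\iota)\Delta(a)=\psi(a)1$ for all $a\in A$. A linear functional $\omega$ on $A$ is left faithful if, for $a\in A$, $\omega(ab)=0$ for all $b\in A$ implies $a=0$; right faithful if $\omega(ca)=0$ for all $c\in A$ implies $a=0$; faithful if both. *)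

(* Defs.v *)
From HB Require Import structures.
From mathcomp Require Import all_boot all_order all_algebra.
From mathcomp Require Import boolp.
From mathcomp Require Import finmap monalg.

Set Implicit Arguments.
Unset Strict Implicit.
Unset Printing Implicit Defensive.

Import GRing.Theory.
Local Open Scope ring_scope.
Local Open Scope quotient_scope.

(* The algebraic tensor product of two modules: the free module on U * V,
   modulo the submodule generated by the bilinearity relations.  MathComp has
   no tensor product of possibly infinite-dimensional modules. *)
Section TensorModule.
Variables (K : comNzRingType) (U V : lmodType K).

Local Notation free := {malg K[(U * V)%type]}.

Inductive tensor_rel : free -> Prop :=
| tensor_rel0 : tensor_rel 0
| tensor_relB x y : tensor_rel x -> tensor_rel y -> tensor_rel (x - y)
| tensor_relZ c x : tensor_rel x -> tensor_rel (c *: x)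
| tensor_relDl u u' v :
    tensor_rel (<< (u + u', v) >> - << (u, v) >> - << (u', v) >>)
| tensor_relDr u v v' :
    tensor_rel (<< (u, v + v') >> - << (u, v) >> - << (u, v') >>)
| tensor_relZl c u v : tensor_rel (<< (c *: u, v) >> - c *: << (u, v) >>)
| tensor_relZr c u v : tensor_rel (<< (u, c *: v) >> - c *: << (u, v) >>).

Definition tensor_null : {pred free} := fun x => `[< tensor_rel x >].

Fact tensor_null_zmod_closed : zmod_closed tensor_null.
Proof.
split; first by apply/asboolP; exact: tensor_rel0.
by move=> x y /asboolP xr /asboolP yr; apply/asboolP; exact: tensor_relB.
Qed.

HB.instance Definition _ :=
  GRing.isZmodClosed.Build free tensor_null tensor_null_zmod_closed.

Definition tensor : Type := Quotient.quot tensor_null.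

HB.instance Definition _ := GRing.Zmodule.on tensor.
HB.instance Definition _ := ZmodQuotient.on tensor.

Definition tensor_scale (c : K) (x : tensor) : tensor :=
  \pi_tensor (c *: repr x).

Lemma eq_pi_tensor (x y : free) :
  (\pi_tensor x = \pi_tensor y) <-> tensor_rel (x - y).
Proof.
have E := Quotient.idealrBE tensor_null x y.
split=> [/eqP xy|xy]; first by move: xy; rewrite -E => /asboolP.
by apply/eqP; rewrite -E unfold_in; apply/asboolP.
Qed.

Lemma pi_tensorZ c (x : free) :
  \pi_tensor (c *: x) = tensor_scale c (\pi_tensor x).
Proof.
apply/eq_pi_tensor; rewrite -scalerBr; apply: tensor_relZ.
by apply/eq_pi_tensor; rewrite reprK.
Qed.

Fact tensor_scaleA a b x :
  tensor_scale a (tensor_scale b x) = tensor_scale (a * b) x.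
Proof. by elim/quotW: x => x; rewrite -(pi_tensorZ b) -!pi_tensorZ scalerA. Qed.

Fact tensor_scale1 : left_id 1 tensor_scale.
Proof. by elim/quotW=> x; rewrite -pi_tensorZ scale1r. Qed.

Fact tensor_scaleDr : right_distributive tensor_scale +%R.
Proof.
move=> c; elim/quotW=> x; elim/quotW=> y.
by rewrite -raddfD -!pi_tensorZ scalerDr raddfD.
Qed.

Fact tensor_scaleDl x : {morph tensor_scale^~ x : a b / a + b}.
Proof.
by elim/quotW: x => x a b; rewrite -!pi_tensorZ scalerDl raddfD.
Qed.

HB.instance Definition _ := GRing.Zmodule_isLmodule.Build K tensor
  tensor_scaleA tensor_scale1 tensor_scaleDr tensor_scaleDl.

Lemma piZ c (x : free) : \pi_tensor (c *: x) = c *: \pi_tensor x.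
Proof. exact: pi_tensorZ. Qed.

Definition tens (u : U) (v : V) : tensor := \pi_tensor << (u, v) >>.

Fact tens_is_bilinear : bilinear_for *:%R *:%R tens.
Proof.
have relE (x y : free) : tensor_rel (x - y) -> \pi_tensor x = \pi_tensor y.
  by move=> xy; apply/eq_pi_tensor.
have Dl u u' v : tens (u + u') v = tens u v + tens u' v.
  rewrite /tens -raddfD; apply: relE; rewrite opprD addrA.
  exact: tensor_relDl.
have Dr u v v' : tens u (v + v') = tens u v + tens u v'.
  rewrite /tens -raddfD; apply: relE; rewrite opprD addrA.
  exact: tensor_relDr.
split=> [v|u] c x y /=.
- by rewrite Dl; congr (_ + _); rewrite -piZ; apply: relE; exact: tensor_relZl.
- by rewrite Dr; congr (_ + _); rewrite -piZ; apply: relE; exact: tensor_relZr.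
Qed.

HB.instance Definition _ :=
  bilinear_isBilinear.Build K U V tensor *:%R *:%R tens tens_is_bilinear.

Lemma tensor_sum (x : tensor) :
  x = \sum_(p <- msupp (repr x)) (repr x)@_p *: tens p.1 p.2.
Proof.
rewrite -[LHS]reprK {1}(monalgE (repr x)) raddf_sum; apply: eq_bigr => p _.
rewrite /tens -piZ -surjective_pairing; congr (\pi _).
by apply/malgP => q; rewrite mcoeffZ !mcoeffU mulrnAr mulr1.
Qed.

Lemma tensor_ind (P : tensor -> Prop) :
    (forall u v, P (tens u v)) -> (forall x y, P x -> P y -> P (x + y)) ->
  forall x, P x.
Proof.
move=> Pt PD x; rewrite (tensor_sum x).
have P0 : P 0 by rewrite -(linear0l [the {bilinear U -> V -> tensor} of tens] 0).
elim/big_ind: _ => // p _.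
by rewrite -(linearZl_LR [the {bilinear U -> V -> tensor} of tens]).
Qed.

End TensorModule.

(* The map induced by f on representatives: well defined when f is bilinear. *)
HB.lock Definition tlift (K : comNzRingType) (U V W : lmodType K)
    (f : U -> V -> W) (x : tensor U V) : W :=
  \sum_(p <- msupp (repr x)) (repr x)@_p *: f p.1 p.2.

Section TensorLift.
Variables (K : comNzRingType) (U V W : lmodType K).
Variable f : {bilinear U -> V -> W}.

Let flift (g : {malg K[(U * V)%type]}) : W :=
  \sum_(p <- msupp g) g@_p *: f p.1 p.2.

Let fliftE g (D : {fset (U * V)%type}) :
  (msupp g `<=` D)%fset -> flift g = \sum_(p <- D) g@_p *: f p.1 p.2.
Proof.
move=> gD; apply: big_fset_incl => // p _ /mcoeff_outdom ->.
by rewrite scale0r.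
Qed.

Fact flift_is_linear : linear flift.
Proof.
move=> c x y; set D := (msupp x `|` msupp y)%fset.
have [xD yD] : (msupp x `<=` D)%fset /\ (msupp y `<=` D)%fset.
  by rewrite fsubsetUl fsubsetUr.
have cD : (msupp (c *: x + y) `<=` D)%fset.
  apply: fsubset_trans (msuppD_le _ _) _; apply: fsetSU; exact: msuppZ_le.
rewrite !(@fliftE _ D) // scaler_sumr -big_split; apply: eq_bigr => p _ /=.
by rewrite mcoeffD mcoeffZ scalerDl scalerA.
Qed.

HB.instance Definition _ :=
  GRing.isLinear.Build K _ W *:%R flift flift_is_linear.

Let fliftU u v : flift << (u, v) >> = f u v.
Proof.
by rewrite (@fliftE _ [fset (u, v)]%fset) ?msuppU_le // big_seq_fset1 mcoeffUU scale1r.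
Qed.

Let flift_rel x : tensor_rel x -> flift x = 0.
Proof.
elim=> [|{}x y _ x0 _ y0|c {}x _ x0|u u' v|u v v'|c u v|c u v].
- by rewrite raddf0.
- by rewrite raddfB /= x0 y0 subrr.
- by rewrite linearZ /= x0 scaler0.
- by rewrite !raddfB /= !fliftU linearDl -addrA -opprD subrr.
- by rewrite !raddfB /= !fliftU linearDr -addrA -opprD subrr.
- by rewrite raddfB /= linearZ /= !fliftU linearZl_LR subrr.
- by rewrite raddfB /= linearZ /= !fliftU linearZr_LR subrr.
Qed.

Let tlift_pi g : tlift f (\pi g) = flift g.
Proof.
apply/eqP; rewrite -subr_eq0 tlift.unlock -[X in X - _]/(flift _) -raddfB /=; apply/eqP.
by apply: flift_rel; apply/eq_pi_tensor; rewrite reprK.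
Qed.

Fact tlift_is_linear : linear (tlift f).
Proof.
move=> c; elim/quotW=> x; elim/quotW=> y.
by rewrite -piZ -raddfD !tlift_pi linearP.
Qed.

HB.instance Definition _ :=
  GRing.isLinear.Build K (tensor U V) W *:%R (tlift f) tlift_is_linear.

Lemma tlift_tens u v : tlift f (tens u v) = f u v.
Proof. by rewrite tlift_pi fliftU. Qed.

Lemma tlift_unique (g : {linear tensor U V -> W}) :
  (forall u v, g (tens u v) = f u v) -> g =1 tlift f.
Proof.
move=> gE; elim/tensor_ind=> [u v|x y gx gy]; first by rewrite gE tlift_tens.
by rewrite !raddfD /= gx gy.
Qed.

End TensorLift.

Section TensorMap.
Variables (K : comNzRingType) (U V U' V' : lmodType K).

Definition tens2 (f : U -> U') (g : V -> V') (u : U) (v : V) : tensor U' V' :=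
  tens (f u) (g v).

Definition tmap (f : U -> U') (g : V -> V') : tensor U V -> tensor U' V' :=
  tlift (tens2 f g).

Variables (f : {linear U -> U'}) (g : {linear V -> V'}).

Fact tens2_is_bilinear : bilinear_for *:%R *:%R (tens2 f g).
Proof.
by split=> [v|u] c x y; rewrite /tens2 /= linearP ?linearPl ?linearPr.
Qed.

HB.instance Definition _ := bilinear_isBilinear.Build K U V (tensor U' V')
  *:%R *:%R (tens2 f g) tens2_is_bilinear.

HB.instance Definition _ := GRing.Linear.copy (tmap f g) (tlift (tens2 f g)).

Lemma tmap_tens u v : tmap f g (tens u v) = tens (f u) (g v).
Proof. exact: tlift_tens. Qed.

End TensorMap.

Section TensorAssoc.
Variables (K : comNzRingType) (U V W : lmodType K).

Definition tassoc_fun (x : tensor U V) (w : W) : tensor U (tensor V W) :=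
  tmap idfun (applyr (@tens K V W) w) x.

(* The isomorphism (u * v) * w |-> u * (v * w) under which the two iterated
   tensor products are identified. *)
Definition tassoc : tensor (tensor U V) W -> tensor U (tensor V W) :=
  tlift tassoc_fun.

Fact tassoc_fun_is_bilinear : bilinear_for *:%R *:%R tassoc_fun.
Proof.
split=> [w|x] c y z; first exact: linearP.
rewrite /= /tassoc_fun; elim/tensor_ind: x => [u v|x x' IHx IHx'].
  by rewrite !tmap_tens /= /applyr linearPr linearPr.
have D w := raddfD (tmap idfun (applyr (@tens K V W) w)) x x'.
by rewrite !D /= IHx IHx' scalerDr addrACA.
Qed.

HB.instance Definition _ := bilinear_isBilinear.Build K (tensor U V) W
  (tensor U (tensor V W)) *:%R *:%R tassoc_fun tassoc_fun_is_bilinear.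

HB.instance Definition _ := GRing.Linear.copy tassoc (tlift tassoc_fun).

Lemma tassoc_tens u v w : tassoc (tens (tens u v) w) = tens u (tens v w).
Proof. by rewrite /tassoc tlift_tens /= /tassoc_fun tmap_tens. Qed.

End TensorAssoc.

Section TensorSlice.
Variables (K : comNzRingType) (U V : lmodType K).

Definition scale_right (phi : V -> K) (u : U) (v : V) : U := phi v *: u.
Definition scale_left (psi : U -> K) (u : U) (v : V) : V := psi u *: v.

(* iota (x) phi and psi (x) iota, with U (x) K = U and K (x) V = V. *)
Definition slice_right (phi : V -> K) : tensor U V -> U :=
  tlift (scale_right phi).
Definition slice_left (psi : U -> K) : tensor U V -> V :=
  tlift (scale_left psi).

Variables (phi : {scalar V}) (psi : {scalar U}).

Fact scale_right_is_bilinear : bilinear_for *:%R *:%R (scale_right phi).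
Proof.
split=> [v|u] c x y; rewrite /= /scale_right.
  by rewrite scalerDr !scalerA mulrC.
by rewrite linearP scalerDl scalerA.
Qed.

Fact scale_left_is_bilinear : bilinear_for *:%R *:%R (scale_left psi).
Proof.
split=> [v|u] c x y; rewrite /= /scale_left.
  by rewrite linearP scalerDl scalerA.
by rewrite scalerDr !scalerA mulrC.
Qed.

HB.instance Definition _ := bilinear_isBilinear.Build K U V U
  *:%R *:%R (scale_right phi) scale_right_is_bilinear.
HB.instance Definition _ := bilinear_isBilinear.Build K U V V
  *:%R *:%R (scale_left psi) scale_left_is_bilinear.

HB.instance Definition _ :=
  GRing.Linear.copy (slice_right phi) (tlift (scale_right phi)).
HB.instance Definition _ :=
  GRing.Linear.copy (slice_left psi) (tlift (scale_left psi)).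

Lemma slice_right_tens u v : slice_right phi (tens u v) = phi v *: u.
Proof. exact: tlift_tens. Qed.

Lemma slice_left_tens u v : slice_left psi (tens u v) = psi u *: v.
Proof. exact: tlift_tens. Qed.

End TensorSlice.

Section AlgebraMul.
Variables (K : comNzRingType) (A : algType K).

Fact mul_is_bilinear :
  bilinear_for *:%R *:%R ( *%R : A -> A -> A).
Proof.
split=> [b|a] c x y /=; first by rewrite mulrDl -scalerAl.
by rewrite mulrDr -scalerAr.
Qed.

HB.instance Definition _ := bilinear_isBilinear.Build K A A A
  *:%R *:%R (@GRing.mul A) mul_is_bilinear.

(* The multiplication, as a linear map on the tensor square. *)
Definition mult : tensor A A -> A := tlift *%R.

HB.instance Definition _ := GRing.Linear.copy mult (tlift *%R).

Lemma mult_tens a b : mult (tens a b) = a * b.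
Proof. exact: tlift_tens. Qed.

End AlgebraMul.

Definition tensor_act (K : comNzRingType) (A B : algType K) (y : tensor A B)
    (a : A) (b : B) : tensor A B :=
  tmap (a \*o idfun) (b \*o idfun) y.

HB.lock Definition tensor_mul (K : comNzRingType) (A B : algType K)
    (x y : tensor A B) : tensor A B :=
  tlift (tensor_act y) x.

(* The algebra structure of a tensor product of algebras.  Only a possibly
   trivial ring, as A (x) B may vanish over a general K. *)
Section TensorAlgebra.
Variables (K : comNzRingType) (A B : algType K).

Local Notation tmul := (@tensor_mul K A B).

Fact tensor_act_is_bilinear (y : tensor A B) : bilinear_for *:%R *:%R (tensor_act y).
Proof.
split=> [b|a] c u v; rewrite /= /tensor_act;
  elim/tensor_ind: y => [a' b'|y z IHy IHz].
- by rewrite !tmap_tens /= mulrDl -scalerAl linearPl.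
- have D w := raddfD (tmap (w \*o idfun) (b \*o idfun)) y z.
  by rewrite !D /= IHy IHz scalerDr addrACA.
- by rewrite !tmap_tens /= mulrDl -scalerAl linearPr.
- have D w := raddfD (tmap (a \*o idfun) (w \*o idfun)) y z.
  by rewrite !D /= IHy IHz scalerDr addrACA.
Qed.

HB.instance Definition _ (y : tensor A B) :=
  bilinear_isBilinear.Build K A B (tensor A B)
  *:%R *:%R (tensor_act y) (tensor_act_is_bilinear y).

Lemma tensor_mul_tens (a a' : A) (b b' : B) :
  tmul (tens a b) (tens a' b') = tens (a * a') (b * b').
Proof. by rewrite tensor_mul.unlock tlift_tens /= /tensor_act tmap_tens. Qed.

Fact tensor_mulDl : left_distributive tmul +%R.
Proof. by move=> x y z; rewrite tensor_mul.unlock raddfD. Qed.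

Fact tensor_mulDr : right_distributive tmul +%R.
Proof.
move=> x y z; elim/tensor_ind: x => [a b|x x' IHx IHx'].
  by rewrite tensor_mul.unlock !tlift_tens /= /tensor_act raddfD.
by rewrite !tensor_mulDl IHx IHx' addrACA.
Qed.

Fact tensor_mulA : associative tmul.
Proof.
move=> x y z; elim/tensor_ind: x => [a b|x x' IHx IHx']; last first.
  by rewrite !tensor_mulDl IHx IHx'.
elim/tensor_ind: y => [a' b'|y y' IHy IHy']; last first.
  by rewrite !(tensor_mulDl, tensor_mulDr) IHy IHy'.
elim/tensor_ind: z => [a'' b''|z z' IHz IHz']; last first.
  by rewrite !tensor_mulDr IHz IHz'.
by rewrite !tensor_mul_tens !mulrA.
Qed.

Fact tensor_mul1l : left_id (tens 1 1) tmul.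
Proof.
elim/tensor_ind=> [a b|x y IHx IHy]; first by rewrite tensor_mul_tens !mul1r.
by rewrite tensor_mulDr IHx IHy.
Qed.

Fact tensor_mul1r : right_id (tens 1 1) tmul.
Proof.
elim/tensor_ind=> [a b|x y IHx IHy]; first by rewrite tensor_mul_tens !mulr1.
by rewrite tensor_mulDl IHx IHy.
Qed.

HB.instance Definition _ := GRing.Zmodule_isPzRing.Build (tensor A B)
  tensor_mulA tensor_mul1l tensor_mul1r tensor_mulDl tensor_mulDr.

Lemma tensM (a a' : A) (b b' : B) :
  tens a b * tens a' b' = tens (a * a') (b * b') :> tensor A B.
Proof. exact: tensor_mul_tens. Qed.

Lemma tens1 : 1 = tens 1 1 :> tensor A B.
Proof. by []. Qed.

End TensorAlgebra.

Section HopfAlgebra.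
Variables (K : comNzRingType) (A : algType K).
Implicit Types (Delta : {linear A -> tensor A A}) (S : {linear A -> A}).
Implicit Types (eps : {lrmorphism A -> K | *%R}) (phi psi omega : {scalar A}).

(* Delta 1 = 1 is not required here. *)
Definition coproduct Delta : Prop :=
  {morph Delta : a b / a * b} /\
  forall a, tassoc (tmap Delta idfun (Delta a)) = tmap idfun Delta (Delta a).

Definition left_integral Delta phi : Prop :=
  (exists a, phi a != 0) /\ forall a, slice_right phi (Delta a) = (phi a)%:A.

Definition right_integral Delta psi : Prop :=
  (exists a, psi a != 0) /\ forall a, slice_left psi (Delta a) = (psi a)%:A.

Definition left_faithful omega : Prop :=
  forall a, (forall b, omega (a * b) = 0) -> a = 0.

Definition right_faithful omega : Prop :=
  forall a, (forall c, omega (c * a) = 0) -> a = 0.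

Definition faithful omega : Prop := left_faithful omega /\ right_faithful omega.

Definition counit Delta eps : Prop :=
  forall a, slice_left eps (Delta a) = a /\ slice_right eps (Delta a) = a.

Definition antipode Delta eps S : Prop :=
  forall a, mult (tmap S idfun (Delta a)) = (eps a)%:A /\
            mult (tmap idfun S (Delta a)) = (eps a)%:A.

Definition hopf_structure Delta eps S : Prop :=
  [/\ coproduct Delta, Delta 1 = 1, counit Delta eps & antipode Delta eps S].

Definition hopf_algebra Delta : Prop := exists eps S, hopf_structure Delta eps S.

Definition hopf_algebra_with_invertible_antipode Delta : Prop :=
  exists eps S, hopf_structure Delta eps S /\ bijective S.

End HopfAlgebra.

(* Main.v *)
(* Let can1 (a (x) b) = Delta a (1 (x) b) and can2 (a (x) b) = (a (x) 1) Delta b.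
   Applying psi to the first leg of Delta c can1 y, and phi to the second leg of
   can2 y Delta c, shows by faithfulness that both maps are injective.
   Invariance of phi gives, in Sweedler notation,
     can1 (a_(1) phi(a_(2) b_(2)) (x) b_(1)) = a_(1) phi(a_(2) b) (x) 1,
   where the preimage has product phi(a b) 1.  By faithfulness the elements
   a_(1) phi(a_(2) b) span the left leg of Delta, and symmetrically for can2,
   psi and the right leg.  Hence Delta a = sum p_i (x) q_i with
   p_i (x) 1 = can1 y_i, q_i in the right leg and mult y_i = c_i 1; injectivity
   of can1 forces sum y_i (1 (x) q_i) = a (x) 1, so a = sum c_i q_i lies in the
   right leg.  So both legs are all of A, can1 and can2 are bijective, and their
   inverses yield counit and antipode.  When the integrals are faithful on both
   sides the same applies to the opposite algebra with the same Delta, and its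
   antipode is inverse to the first one. *)

Require Import Defs.
From HB Require Import structures.
From mathcomp Require Import all_boot all_order all_algebra.
From mathcomp Require Import boolp reals complex.

Set Implicit Arguments.
Unset Strict Implicit.
Unset Printing Implicit Defensive.

Import GRing.Theory.
Local Open Scope ring_scope.

(** * Bundling maps known to be linear, scalar or bilinear *)

Lemma exists_linear (K : comNzRingType) (U V : lmodType K) (f : U -> V) :
  linear f -> exists F : {linear U -> V}, F =1 f.
Proof.
move=> hf; pose F : {linear U -> V} :=
  HB.pack f (GRing.isLinear.Build K U V *:%R f hf).
by exists F.
Qed.

Lemma exists_scalar (K : comNzRingType) (U : lmodType K) (f : U -> K) :
  scalar f -> exists F : {scalar U}, F =1 f.
Proof.
move=> hf; pose F : {scalar U} :=
  HB.pack f (GRing.isLinear.Build K U K *%R f hf).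
by exists F.
Qed.

Lemma exists_bilinear (K : comNzRingType) (U V W : lmodType K)
    (f : U -> V -> W) :
  bilinear_for *:%R *:%R f -> exists F : {bilinear U -> V -> W}, F =2 f.
Proof.
move=> hf; pose F : {bilinear U -> V -> W} := HB.pack f
  (bilinear_isBilinear.Build K U V W *:%R *:%R f hf).
by exists F.
Qed.

Lemma linear_bigsum (K : comNzRingType) (U W : lmodType K) (J : Type)
    (s : seq J) (F : J -> U -> W) :
  (forall j, linear (F j)) -> linear (fun u => \sum_(j <- s) F j u).
Proof.
move=> hF c u v; rewrite scaler_sumr -big_split; apply: eq_bigr => j _.
exact: hF.
Qed.

(** * Finite decompositions of tensors *)

Section TensorDecomposition.
Variables (K : comNzRingType) (U V : lmodType K).

Definition sum_tens (s : seq (U * V)) : tensor U V :=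
  \sum_(p <- s) tens p.1 p.2.

Lemma sum_tens_surj x : exists s, sum_tens s = x.
Proof.
elim/tensor_ind: x => [u v|x y [s <-] [t <-]].
  by exists [:: (u, v)]; rewrite /sum_tens big_seq1.
by exists (s ++ t); rewrite /sum_tens big_cat.
Qed.

(** An arbitrary decomposition, fixed by choice. Sums over [tensor_seq (Delta a)] serve as Sweedler
    notation; independence of the choice comes from [eq_sum_tens]. *)
Definition tensor_seq x : seq (U * V) := sval (cid (sum_tens_surj x)).

Lemma tensor_seqK x : sum_tens (tensor_seq x) = x.
Proof. exact: svalP (cid (sum_tens_surj x)). Qed.

Lemma tensor_seqE (W : lmodType K) (f : {linear tensor U V -> W}) x :
  f x = \sum_(p <- tensor_seq x) f (tens p.1 p.2).
Proof. by rewrite -[in LHS](tensor_seqK x) raddf_sum. Qed.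

Lemma tlift_sum_tens (W : lmodType K) (f : U -> V -> W) s :
    bilinear_for *:%R *:%R f ->
  tlift f (sum_tens s) = \sum_(p <- s) f p.1 p.2.
Proof.
move=> hf; pose F : {bilinear U -> V -> W} := HB.pack f
  (bilinear_isBilinear.Build K U V W *:%R *:%R f hf).
rewrite -[LHS]/(tlift F _) raddf_sum; apply: eq_bigr => p _.
exact: (tlift_tens F).
Qed.

Lemma eq_sum_tens (W : lmodType K) (f : U -> V -> W) s t :
    bilinear_for *:%R *:%R f -> sum_tens s = sum_tens t ->
  \sum_(p <- s) f p.1 p.2 = \sum_(p <- t) f p.1 p.2.
Proof. by move=> hf st; rewrite -!tlift_sum_tens ?st. Qed.

End TensorDecomposition.

(** * Confining the legs of a tensor to submodules *)

Section TensorLegs.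
Variable K : fieldType.

Definition submodule (U : lmodType K) (P : U -> Prop) : Prop :=
  P 0 /\ forall c u v, P u -> P v -> P (c *: u + v).

Lemma submoduleB (U : lmodType K) (P : U -> Prop) :
  submodule P -> forall u v, P u -> P v -> P (u - v).
Proof. by case=> _ hP u v Pu Pv; rewrite addrC -scaleN1r; apply: hP. Qed.

Lemma submoduleZ (U : lmodType K) (P : U -> Prop) :
  submodule P -> forall c u, P u -> P (c *: u).
Proof. by case=> P0 hP c u Pu; rewrite -[_ *: _]addr0; apply: hP. Qed.

Variables (U V : lmodType K).

(* Elimination on the first legs: a functional that does not vanish on the head
   expresses its second leg through a slice and the remaining terms. *)
Lemma sum_tens_leg2 (I : Type) (om : I -> {scalar U}) (P : U -> Prop)
    (Q : V -> Prop) (s : seq (U * V)) :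
    (forall u, (forall i, om i u = 0) -> u = 0) -> submodule P -> submodule Q ->
    (forall p, p \in s -> P p.1) ->
    (forall i, Q (slice_left (om i) (sum_tens s))) ->
  exists s', sum_tens s' = sum_tens s /\ forall p, p \in s' -> P p.1 /\ Q p.2.
Proof.
(* Induction on a bound for the length, since the tail is modified before the recursive call. *)
move=> sep hP hQ; move: {2}(size s) (leqnn (size s)) => n.
elim: n s => [|n IHn] [|[u0 v0] s] //= sn Ps Qs; try by exists [::].
have Ps' p : p \in s -> P p.1 by move=> ps; apply: Ps; rewrite inE ps orbT.
have [u00|u0N0] := pselect (u0 = 0).
  have E : sum_tens ((u0, v0) :: s) = sum_tens s.
    by rewrite /sum_tens big_cons /= u00 linear0l add0r.
  by rewrite E in Qs *; apply: IHn.
have [i iN0] : exists i, om i u0 != 0.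
  apply: contrapT => H; apply: u0N0; apply: sep => i.
  by apply/eqP/negPn/negP => h; apply: H; exists i.
set x := sum_tens _ in Qs *; set c := om i u0 in iN0.
set w := c^-1 *: slice_left (om i) x.
have Qw : Q w by apply: submoduleZ.
(* The multiples of [u0] taken off the first legs are collected in the second leg [w] of [u0]. *)
pose s1 := [seq (p.1 - (c^-1 * om i p.1) *: u0, p.2) | p <- s].
have xE : x = tens u0 w + sum_tens s1.
  rewrite /w /x /sum_tens big_cons raddfD /= slice_left_tens -/c scalerDr.
  rewrite scalerA mulVf // scale1r linearDr -addrA; congr (_ + _).
  rewrite raddf_sum scaler_sumr linear_sumr big_map -big_split.
  apply: eq_bigr => p _ /=; rewrite slice_left_tens.
  by rewrite linearBl linearZl_LR scalerA linearZr_LR addrC subrK.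
have [|p|j|s' [s'E s'P]] := IHn s1.
- by rewrite size_map.
- case/mapP=> q qs -> /=; apply: submoduleB; [exact: hP|exact: Ps'|].
  by apply: (submoduleZ hP); apply: (Ps (u0, v0)); rewrite mem_head.
- have -> : sum_tens s1 = x - tens u0 w by rewrite xE addrC addKr.
  rewrite raddfB /= slice_left_tens; apply: (submoduleB hQ); first exact: Qs.
  exact: (submoduleZ hQ).
exists ((u0, w) :: s'); split; first by rewrite /sum_tens big_cons xE -s'E.
move=> p; rewrite inE => /orP [/eqP->|]; last exact: s'P.
by split=> //=; apply: (Ps (u0, v0)); rewrite mem_head.
Qed.

End TensorLegs.

Section TensorSwap.
Variables (K : fieldType) (U V : lmodType K).

Let swap (W W' : Type) (s : seq (W * W')) := [seq (p.2, p.1) | p <- s].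

Let sum_tens_swap (W W' : lmodType K) (s t : seq (W * W')) :
  sum_tens s = sum_tens t -> sum_tens (swap s) = sum_tens (swap t).
Proof.
move=> st; rewrite /sum_tens !big_map.
apply: (eq_sum_tens (f := fun u v => tens v u)) => //.
by split=> [v|u] c x y; rewrite ?linearPl ?linearPr.
Qed.

(** Mirror image of [sum_tens_leg2], obtained by swapping the two factors and putting the trivial
    predicate on the other leg. *)
Lemma sum_tens_leg1 (I : Type) (om : I -> {scalar V}) (P : U -> Prop)
    (s : seq (U * V)) :
    (forall v, (forall i, om i v = 0) -> v = 0) -> submodule P ->
    (forall i, P (slice_right (om i) (sum_tens s))) ->
  exists s', sum_tens s' = sum_tens s /\ forall p, p \in s' -> P p.1.
Proof.
move=> sep hP Ps.
have [| | |s' [s'E s'P]] :=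
  @sum_tens_leg2 K V U I om (fun=> True) P (swap s) sep _ hP.
- by [].
- by [].
- move=> i; have := Ps i; rewrite /sum_tens !raddf_sum big_map.
  congr (P _); apply: eq_bigr => p _ /=.
  by rewrite slice_left_tens slice_right_tens.
exists (swap s'); split.
  by rewrite (sum_tens_swap s'E) /sum_tens !big_map.
by move=> p /mapP [q qs' ->]; have [] := s'P q qs'.
Qed.

End TensorSwap.

(** * Compatibility of scaling with the product of tensors *)

Section TensorScale.
Variables (K : comNzRingType) (A B : algType K).
Implicit Types x y : tensor A B.

Lemma tensor_scaleAl c x y : c *: (x * y) = (c *: x) * y.
Proof.
elim/tensor_ind: x => [a b|x x' IHx IHx']; last first.
  by rewrite scalerDr !mulrDl scalerDr IHx IHx'.
elim/tensor_ind: y => [a' b'|y y' IHy IHy']; last first.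
  by rewrite !mulrDr scalerDr IHy IHy'.
by rewrite -linearZl_LR !tensM -linearZl_LR -scalerAl.
Qed.

Lemma tensor_scaleAr c x y : c *: (x * y) = x * (c *: y).
Proof.
elim/tensor_ind: x => [a b|x x' IHx IHx']; last first.
  by rewrite !mulrDl scalerDr IHx IHx'.
elim/tensor_ind: y => [a' b'|y y' IHy IHy']; last first.
  by rewrite scalerDr !mulrDr scalerDr IHy IHy'.
by rewrite -linearZl_LR !tensM -linearZl_LR -scalerAr.
Qed.

End TensorScale.

(** * Sweedler calculus for the coproduct *)

Section Sweedler.
Variables (K : comNzRingType) (A : algType K).
Variable Delta : {linear A -> tensor A A}.
Hypothesis hDelta : coproduct Delta.

Local Notation sw a := (tensor_seq (Delta a)).

Lemma sum_coproduct (W : lmodType K) (f : A -> A -> W) a s :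
    bilinear_for *:%R *:%R f -> sum_tens s = Delta a ->
  \sum_(p <- sw a) f p.1 p.2 = \sum_(p <- s) f p.1 p.2.
Proof. by move=> hf sE; apply: eq_sum_tens; rewrite ?tensor_seqK. Qed.

Lemma sum_coproductM (W : lmodType K) (f : A -> A -> W) a b :
    bilinear_for *:%R *:%R f ->
  \sum_(p <- sw (a * b)) f p.1 p.2 =
  \sum_(p <- sw a) \sum_(q <- sw b) f (p.1 * q.1) (p.2 * q.2).
Proof.
move=> hf.
pose s := [seq (p.1 * q.1, p.2 * q.2) | p <- sw a, q <- sw b].
rewrite (@sum_coproduct _ f _ s) //.
  by rewrite big_allpairs_dep.
rewrite hDelta.1 -[in RHS](tensor_seqK (Delta a)).
rewrite -[in RHS](tensor_seqK (Delta b)).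
rewrite /sum_tens big_allpairs_dep mulr_suml; apply: eq_bigr => p _.
by rewrite mulr_sumr; apply: eq_bigr => q _; rewrite tensM.
Qed.

(** Lifting the trilinear [h] twice gives a linear map on the triple tensor product; the two sums
    are its values at the two sides of coassociativity. *)
Lemma sum_coproductA (W : lmodType K) (h : A -> A -> A -> W) a :
    (forall v w, linear (fun u => h u v w)) ->
    (forall u w, linear (fun v => h u v w)) ->
    (forall u v, linear (fun w => h u v w)) ->
  \sum_(p <- sw a) \sum_(q <- sw p.1) h q.1 q.2 p.2 =
  \sum_(p <- sw a) \sum_(q <- sw p.2) h p.1 q.1 q.2.
Proof.
move=> h1 h2 h3.
have /choice[H HE] u : exists H : {bilinear A -> A -> W}, H =2 h u.
  by apply: exists_bilinear; split=> *; [exact: h2|exact: h3].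
have [|G GE] := @exists_bilinear _ _ _ _ (fun u => tlift (H u)).
  split=> [x|u] c y z; last exact: linearP.
  elim/tensor_ind: x => [v w|x x' IHx IHx'].
    by rewrite !tlift_tens !HE; exact: h1.
  by rewrite 3!raddfD /= IHx IHx' scalerDr addrACA.
have {HE} GE' u v w : tlift G (tens u (tens v w)) = h u v w.
  by rewrite tlift_tens GE tlift_tens HE.
transitivity (tlift G (tassoc (tmap Delta idfun (Delta a)))).
  rewrite -[in RHS](tensor_seqK (Delta a)) /sum_tens !raddf_sum.
  apply: eq_bigr => p _ /=; rewrite tmap_tens.
  rewrite -[in RHS](tensor_seqK (Delta p.1)).
  rewrite /sum_tens linear_sumlz !raddf_sum; apply: eq_bigr => q _ /=.
  by rewrite tassoc_tens GE'.
rewrite hDelta.2 -[in LHS](tensor_seqK (Delta a)) /sum_tens !raddf_sum.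
apply: eq_bigr => p _ /=; rewrite tmap_tens -[in LHS](tensor_seqK (Delta p.2)).
rewrite /sum_tens linear_sumr raddf_sum; apply: eq_bigr => q _ /=.
by rewrite GE'.
Qed.

End Sweedler.

(** * Separating families of functionals detect zero tensors *)

Section TensorSeparation.
Variables (K : fieldType) (U V : lmodType K) (I : Type).

(** This is [sum_tens_leg2] with the zero submodule as [Q]: some decomposition has all its second
    legs equal to zero. *)
Lemma slice_left_eq0 (om : I -> {scalar U}) (x : tensor U V) :
    (forall u, (forall i, om i u = 0) -> u = 0) ->
  (forall i, slice_left (om i) x = 0) -> x = 0.
Proof.
move=> sep x0.
have [||//||s [sx s0]] := @sum_tens_leg2 K U V I om (fun=> True)
  (fun v => v = 0) (tensor_seq x) sep.
- by [].
- by split=> // c u v -> ->; rewrite scaler0 addr0.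
- by move=> i; rewrite tensor_seqK.
rewrite -[x]tensor_seqK -sx /sum_tens big_seq big1 // => p ps.
by have [_ ->] := s0 p ps; rewrite linear0r.
Qed.

Lemma slice_right_eq0 (om : I -> {scalar V}) (x : tensor U V) :
    (forall v, (forall i, om i v = 0) -> v = 0) ->
  (forall i, slice_right (om i) x = 0) -> x = 0.
Proof.
move=> sep x0.
have [||s [sx s0]] :=
  @sum_tens_leg1 K U V I om (fun u => u = 0) (tensor_seq x) sep.
- by split=> // c u v -> ->; rewrite scaler0 addr0.
- by move=> i; rewrite tensor_seqK.
rewrite -[x]tensor_seqK -sx /sum_tens big_seq big1 // => p ps.
by rewrite (s0 p ps) linear0l.
Qed.

End TensorSeparation.

(** * One-sided linearity of the product and of slices *)

Section TensorRightLeftMul.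
Variables (K : comNzRingType) (A : algType K).
Implicit Types y : tensor A A.

Lemma mult_mulr y b : mult (y * tens 1 b) = mult y * b.
Proof.
elim/tensor_ind: y => [u v|y y' IHy IHy']; last first.
  by rewrite mulrDl !raddfD /= mulrDl IHy IHy'.
by rewrite tensM !mult_tens mulr1 mulrA.
Qed.

Lemma mult_mull a y : mult (tens a 1 * y) = a * mult y.
Proof.
elim/tensor_ind: y => [u v|y y' IHy IHy']; last first.
  by rewrite mulrDr !raddfD /= mulrDr IHy IHy'.
by rewrite tensM !mult_tens mul1r mulrA.
Qed.

Lemma slice_left_mulr (om : {scalar A}) y b :
  slice_left om (y * tens 1 b) = slice_left om y * b.
Proof.
elim/tensor_ind: y => [u v|y y' IHy IHy']; last first.
  by rewrite mulrDl !raddfD /= mulrDl IHy IHy'.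
by rewrite tensM !slice_left_tens mulr1 scalerAl.
Qed.

Lemma slice_right_mull (om : {scalar A}) a y :
  slice_right om (tens a 1 * y) = a * slice_right om y.
Proof.
elim/tensor_ind: y => [u v|y y' IHy IHy']; last first.
  by rewrite mulrDr !raddfD /= mulrDr IHy IHy'.
by rewrite tensM !slice_right_tens mul1r scalerAr.
Qed.

End TensorRightLeftMul.

(** * The canonical maps and their interaction with integrals *)

Section CanonicalMaps.
Variables (K : comNzRingType) (A : algType K).
Variable Delta : {linear A -> tensor A A}.
Implicit Types y : tensor A A.

Definition can1_fun (a b : A) : tensor A A := Delta a * tens 1 b.
Definition can2_fun (a b : A) : tensor A A := tens a 1 * Delta b.

Fact can1_fun_is_bilinear : bilinear_for *:%R *:%R can1_fun.
Proof.
split=> [b|a] c x y; rewrite /can1_fun /=.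
  by rewrite linearP mulrDl tensor_scaleAl.
by rewrite linearPr mulrDr tensor_scaleAr.
Qed.

Fact can2_fun_is_bilinear : bilinear_for *:%R *:%R can2_fun.
Proof.
split=> [b|a] c x y; rewrite /can2_fun /=.
  by rewrite linearPl mulrDl tensor_scaleAl.
by rewrite linearP mulrDr tensor_scaleAr.
Qed.

HB.instance Definition _ := bilinear_isBilinear.Build K A A (tensor A A)
  *:%R *:%R can1_fun can1_fun_is_bilinear.
HB.instance Definition _ := bilinear_isBilinear.Build K A A (tensor A A)
  *:%R *:%R can2_fun can2_fun_is_bilinear.

Definition can1 : tensor A A -> tensor A A := tlift can1_fun.
Definition can2 : tensor A A -> tensor A A := tlift can2_fun.

HB.instance Definition _ := GRing.Linear.copy can1 (tlift can1_fun).
HB.instance Definition _ := GRing.Linear.copy can2 (tlift can2_fun).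

Lemma can1_tens a b : can1 (tens a b) = Delta a * tens 1 b.
Proof. exact: tlift_tens. Qed.

Lemma can2_tens a b : can2 (tens a b) = tens a 1 * Delta b.
Proof. exact: tlift_tens. Qed.

Lemma can1_mulr y b : can1 (y * tens 1 b) = can1 y * tens 1 b.
Proof.
elim/tensor_ind: y => [u v|y y' IHy IHy']; last first.
  by rewrite mulrDl !raddfD /= mulrDl IHy IHy'.
by rewrite tensM !can1_tens mulr1 -mulrA tensM mul1r.
Qed.

Lemma can2_mull a y : can2 (tens a 1 * y) = tens a 1 * can2 y.
Proof.
elim/tensor_ind: y => [u v|y y' IHy IHy']; last first.
  by rewrite mulrDr !raddfD /= mulrDr IHy IHy'.
by rewrite tensM !can2_tens mul1r mulrA tensM mulr1.
Qed.

Hypothesis hDelta : coproduct Delta.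

Lemma can1_mull a y : can1 (tens a 1 * y) = Delta a * can1 y.
Proof.
elim/tensor_ind: y => [u v|y y' IHy IHy']; last first.
  by rewrite mulrDr !raddfD /= mulrDr IHy IHy'.
by rewrite tensM !can1_tens mul1r hDelta.1 mulrA.
Qed.

Local Notation sw a := (tensor_seq (Delta a)).

(* In Sweedler notation the preimage is [a_(1) phi(a_(2) b_(2)) (x) b_(1)]. *)
Lemma can1_slice_right phi a b : left_integral Delta phi ->
  exists2 y, can1 y = tens (slice_right (phi \o (b \o* idfun)) (Delta a)) 1
    & mult y = (phi (a * b))%:A.
Proof.
case=> _ hphi.
exists (\sum_(p <- sw a) \sum_(q <- sw b) phi (p.2 * q.2) *: tens p.1 q.1).
  (* By coassociativity [can1] of the preimage is the sum of
     [a_(1) (x) a_(2) b_(1) phi(a_(3) b_(2))]. Multiplicativity regroups the right part as the slice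
     of [Delta (a_(2) b)] by [phi], which invariance makes scalar. *)
  pose h u v w : tensor A A :=
    \sum_(q <- sw b) phi (w * q.2) *: tens u (v * q.1).
  transitivity (\sum_(p <- sw a) \sum_(q <- sw p.1) h q.1 q.2 p.2).
    rewrite raddf_sum; apply: eq_bigr => p _ /=; rewrite raddf_sum.
    rewrite [RHS]exchange_big; apply: eq_bigr => q _ /=.
    rewrite linearZ /= can1_tens.
    rewrite -[in LHS](tensor_seqK (Delta p.1)) /sum_tens mulr_suml scaler_sumr.
    by apply: eq_bigr => r _; rewrite tensM mulr1.
  rewrite sum_coproductA //; first last.
  - move=> u v; apply: linear_bigsum => q c x y.
    by rewrite mulrDl -scalerAl linearP /= scalerDl scalerA.
  - move=> u w; apply: linear_bigsum => q c x y.
    by rewrite mulrDl -scalerAl linearPr scalerDr !scalerA mulrC.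
  - move=> v w; apply: linear_bigsum => q c x y.
    by rewrite linearPl scalerDr !scalerA mulrC.
  rewrite tensor_seqE /= linear_sumlz; apply: eq_bigr => p _ /=.
  rewrite slice_right_tens /= linearZl_LR /=.
  rewrite -(@sum_coproductM _ _ _ _ _
    (fun u v => phi v *: tens p.1 u)) //; last first.
    split=> [v|u] c x y /=; first by rewrite linearPr scalerDr !scalerA mulrC.
    by rewrite linearP scalerDl scalerA.
  have := hphi (p.2 * b); rewrite tensor_seqE /= => E.
  rewrite -linearZr_LR -E linear_sumr; apply: eq_bigr => q _.
  by rewrite slice_right_tens linearZr_LR.
(* The product of the preimage is the slice of [Delta (a * b)] by [phi]. *)
rewrite raddf_sum -hphi tensor_seqE /=.
rewrite (@sum_coproductM _ _ _ hDelta _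
  (fun u v => slice_right phi (tens u v))); last first.
  by split=> [v|u] c x y /=; rewrite ?linearPl ?linearPr linearP.
apply: eq_bigr => p _; rewrite raddf_sum; apply: eq_bigr => q _ /=.
by rewrite linearZ /= mult_tens slice_right_tens.
Qed.

(** Mirror image of [can1_slice_right], with preimage [psi(a_(1) b_(1)) a_(2) (x) b_(2)]. *)
Lemma can2_slice_left psi a b : right_integral Delta psi ->
  exists2 y, can2 y = tens 1 (slice_left (psi \o (a \*o idfun)) (Delta b))
    & mult y = (psi (a * b))%:A.
Proof.
case=> _ hpsi.
exists (\sum_(q <- sw b) \sum_(p <- sw a) psi (p.1 * q.1) *: tens p.2 q.2).
  pose h u v w : tensor A A :=
    \sum_(p <- sw a) psi (p.1 * u) *: tens (p.2 * v) w.
  transitivity (\sum_(q <- sw b) \sum_(p <- sw q.2) h q.1 p.1 p.2).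
    rewrite raddf_sum; apply: eq_bigr => p _ /=; rewrite raddf_sum.
    rewrite [RHS]exchange_big; apply: eq_bigr => q _ /=.
    rewrite linearZ /= can2_tens.
    rewrite -[in LHS](tensor_seqK (Delta p.2)) /sum_tens mulr_sumr scaler_sumr.
    by apply: eq_bigr => r _; rewrite tensM mul1r.
  rewrite -sum_coproductA //; first last.
  - move=> u v; apply: linear_bigsum => q c x y.
    by rewrite linearPr scalerDr !scalerA mulrC.
  - move=> u w; apply: linear_bigsum => q c x y.
    by rewrite mulrDr -scalerAr linearPl scalerDr !scalerA mulrC.
  - move=> v w; apply: linear_bigsum => q c x y.
    by rewrite mulrDr -scalerAr linearP /= scalerDl scalerA.
  rewrite tensor_seqE /= linear_sumr; apply: eq_bigr => q _ /=.
  rewrite slice_left_tens /= linearZr_LR /= exchange_big /=.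
  rewrite -(@sum_coproductM _ _ _ _ _
    (fun u v => psi u *: tens v q.2)) //; last first.
    split=> [v|u] c x y /=; first by rewrite linearP scalerDl scalerA.
    by rewrite linearPl scalerDr !scalerA mulrC.
  have := hpsi (a * q.1); rewrite tensor_seqE /= => E.
  rewrite -linearZl_LR -E linear_sumlz; apply: eq_bigr => p _.
  by rewrite slice_left_tens linearZl_LR.
rewrite raddf_sum -hpsi tensor_seqE /=.
rewrite (@sum_coproductM _ _ _ hDelta _
  (fun u v => slice_left psi (tens u v))); last first.
  by split=> [v|u] c x y /=; rewrite ?linearPl ?linearPr linearP.
rewrite exchange_big; apply: eq_bigr => p _; rewrite raddf_sum.
apply: eq_bigr => q _ /=.
by rewrite linearZ /= mult_tens slice_left_tens.
Qed.

(** On [u (x) v], multiplicativity gives [Delta (c u) (1 (x) v)], and invariance turns its slice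
    into [psi(c u) v]. Thus [can1 y] determines all slices of [y] by the functionals [psi(c -)]. *)
Lemma slice_left_can1 (psi : {scalar A}) c y : right_integral Delta psi ->
  slice_left psi (Delta c * can1 y) = slice_left (psi \o (c \*o idfun)) y.
Proof.
case=> _ hpsi; elim/tensor_ind: y => [u v|y y' IHy IHy']; last first.
  by rewrite !raddfD /= mulrDr raddfD /= IHy IHy'.
rewrite can1_tens mulrA -hDelta.1 slice_left_mulr hpsi slice_left_tens.
by rewrite -scalerAl mul1r.
Qed.

Lemma slice_right_can2 (phi : {scalar A}) c y : left_integral Delta phi ->
  slice_right phi (can2 y * Delta c) = slice_right (phi \o (c \o* idfun)) y.
Proof.
case=> _ hphi; elim/tensor_ind: y => [u v|y y' IHy IHy']; last first.
  by rewrite !raddfD /= mulrDl raddfD /= IHy IHy'.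
rewrite can2_tens -mulrA -hDelta.1 slice_right_mull hphi slice_right_tens.
by rewrite -scalerAr mulr1.
Qed.

End CanonicalMaps.

(** * Convolution of linear endomorphisms *)

Section Convolution.
Variables (K : comNzRingType) (A : algType K).
Variable Delta : {linear A -> tensor A A}.
Hypothesis hDelta : coproduct Delta.
Local Notation sw a := (tensor_seq (Delta a)).

Lemma mult_tmapE (f g : {linear A -> A}) x :
  mult (tmap f g x) = \sum_(p <- tensor_seq x) f p.1 * g p.2.
Proof.
rewrite -[in LHS](tensor_seqK x) /sum_tens !raddf_sum; apply: eq_bigr => p _ /=.
by rewrite tmap_tens mult_tens.
Qed.

(** In the convolution monoid, whose unit is [a |-> eps(a) 1], a left inverse [f] and a right
    inverse [h] of [g] agree by associativity. *)
Lemma convolution_inverse_unique (eps : {scalar A}) (f g h : {linear A -> A}) :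
    (forall a, slice_left eps (Delta a) = a) ->
    (forall a, slice_right eps (Delta a) = a) ->
    (forall a, mult (tmap f g (Delta a)) = (eps a)%:A) ->
    (forall a, mult (tmap g h (Delta a)) = (eps a)%:A) ->
  f =1 h.
Proof.
move=> epsl epsr fg gh a.
transitivity (\sum_(p <- sw a) \sum_(q <- sw p.1) f q.1 * g q.2 * h p.2).
  rewrite (sum_coproductA hDelta
    (h := fun u v w => f u * g v * h w)); first last.
  - by move=> u v c x y; rewrite linearP mulrDr -scalerAr.
  - by move=> u v c x y; rewrite linearP mulrDr mulrDl -scalerAr -scalerAl.
  - by move=> u v c x y; rewrite linearP !mulrDl -!scalerAl.
  rewrite -[in LHS](epsr a) tensor_seqE raddf_sum; apply: eq_bigr => p _ /=.
  rewrite slice_right_tens linearZ /= -[eps p.2 *: _]mulr1.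
  rewrite -scalerAl scalerAr -gh.
  by rewrite mult_tmapE mulr_sumr; apply: eq_bigr => q _; rewrite mulrA.
rewrite -[in RHS](epsl a) [slice_left _ _]tensor_seqE raddf_sum.
apply: eq_bigr => p _ /=.
rewrite slice_left_tens linearZ /= -[eps p.1 *: _]mul1r -scalerAr scalerAl -fg.
by rewrite mult_tmapE mulr_suml.
Qed.

End Convolution.

(** * Counit and antipode from inverses of the canonical maps *)

Section HopfOfInverses.
Variables (K : fieldType) (A : algType K) (Delta : {linear A -> tensor A A}).
Hypothesis hDelta : coproduct Delta.

Lemma scaler1_inj : injective (fun c : K => c%:A : A).
Proof. exact: (fmorph_inj (in_alg A)). Qed.

Lemma slice_left_mul3 (eps : {scalar A}) (u v : A) (z : tensor A A) :
    {morph eps : x y / x * y} ->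
  slice_left eps (tens u 1 * z * tens 1 v) = eps u *: slice_left eps z * v.
Proof.
move=> epsM; rewrite slice_left_mulr; congr (_ * _).
elim/tensor_ind: z => [a b|z z' IHz IHz']; last first.
  by rewrite mulrDr !raddfD /= IHz IHz'.
rewrite tensM (slice_left_tens eps (u * a)) slice_left_tens.
by rewrite mul1r epsM scalerA.
Qed.

(** Both values equal [eps1 (x) eps2] applied to [Delta a]. *)
Lemma left_right_counit (eps1 eps2 : {scalar A}) :
    (forall a, slice_left eps1 (Delta a) = a) ->
    (forall a, slice_right eps2 (Delta a) = a) ->
  eps1 =1 eps2.
Proof.
move=> epsl epsr a; rewrite -[in LHS](epsr a) -[in RHS](epsl a).
elim/tensor_ind: (Delta a) => [u v|x y IHx IHy].
  by rewrite slice_right_tens slice_left_tens !linearZ /= mulrC.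
by rewrite !raddfD /= IHx IHy.
Qed.

(* If [R1] and [R2] invert the canonical maps and send [a (x) 1] and [1 (x) a]
   to tensors with scalar product, this scalar is the counit of [a]; applying
   the counit to the preimage itself gives the antipode. *)
Lemma hopf_of_inverses (R1 R2 : {linear tensor A A -> tensor A A}) :
    cancel R1 (can1 Delta) -> cancel (can1 Delta) R1 ->
    cancel R2 (can2 Delta) -> cancel (can2 Delta) R2 ->
    (forall a, exists c, mult (R1 (tens a 1)) = c%:A) ->
    (forall a, exists c, mult (R2 (tens 1 a)) = c%:A) ->
  exists eps S, hopf_structure Delta eps S /\ forall a b, S (a * b) = S b * S a.
Proof.
move=> R1K can1K R2K can2K /choice[e1 he1] /choice[e2 he2].
(* The chosen scalars are determined by [a], because [K] embeds in [A]; hence they depend linearly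
   on [a]. *)
have [eps1 E1] : exists eps : {scalar A}, eps =1 e1.
  apply: exists_scalar => c a b; apply: scaler1_inj.
  by rewrite -he1 linearPl !linearP /= !he1 scalerDl scalerA.
have [eps2 E2] : exists eps : {scalar A}, eps =1 e2.
  apply: exists_scalar => c a b; apply: scaler1_inj.
  by rewrite -he2 linearPr !linearP /= !he2 scalerDl scalerA.
have R1_mulr x b : R1 (x * tens 1 b) = R1 x * tens 1 b.
  by apply: (can_inj can1K); rewrite R1K can1_mulr R1K.
have R2_mull a x : R2 (tens a 1 * x) = tens a 1 * R2 x.
  by apply: (can_inj can2K); rewrite R2K can2_mull R2K.
have multR1 x : mult (R1 x) = slice_left eps1 x.
  elim/tensor_ind: x => [u v|x y IHx IHy]; last by rewrite !raddfD /= IHx IHy.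
  have -> : tens u v = tens u 1 * tens 1 v by rewrite tensM mulr1 mul1r.
  by rewrite R1_mulr mult_mulr he1 slice_left_mulr slice_left_tens E1.
have multR2 x : mult (R2 x) = slice_right eps2 x.
  elim/tensor_ind: x => [u v|x y IHx IHy]; last by rewrite !raddfD /= IHx IHy.
  have -> : tens u v = tens u 1 * tens 1 v by rewrite tensM mulr1 mul1r.
  by rewrite R2_mull mult_mull he2 slice_right_mull slice_right_tens E2.
have D1 a : can1 Delta (tens a 1) = Delta a by rewrite can1_tens -tens1 mulr1.
have D2 a : can2 Delta (tens 1 a) = Delta a by rewrite can2_tens -tens1 mul1r.
have epsl a : slice_left eps1 (Delta a) = a.
  by rewrite -multR1 -D1 can1K mult_tens mulr1.
have epsr2 a : slice_right eps2 (Delta a) = a.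
  by rewrite -multR2 -D2 can2K mult_tens mul1r.
have eps12 := left_right_counit epsl epsr2.
have epsr a : slice_right eps1 (Delta a) = a.
  rewrite -[RHS]epsr2 !tensor_seqE; apply: eq_bigr => p _ /=.
  by rewrite !slice_right_tens eps12.
(* Left multiplication by [Delta 1] fixes the image of [can1], which contains 1. *)
have Delta1 : Delta 1 = 1.
  by have := can1_mull hDelta 1 (R1 1); rewrite -tens1 mul1r R1K mulr1.
have eps1M : {morph eps1 : x y / x * y}.
  move=> c x.
  (* Both sides are [eps1 (x) eps1] at [y (x (x) 1)]. For [y = Delta c] the right side is
     [eps1 (c x)]. On the left, [Delta c (x (x) 1)] is [can1] of [(c (x) 1) R1 (x (x) 1)], whose
     product is [eps1(x) c]. *)
  have H y :
      eps1 (slice_left eps1 (y * tens x 1)) = eps1 (slice_right eps1 y * x).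
    elim/tensor_ind: y => [u v|y y' IHy IHy'].
      rewrite tensM mulr1 slice_left_tens slice_right_tens -scalerAl.
      by rewrite !linearZ /= mulrC.
    by rewrite mulrDl !raddfD /= mulrDl raddfD IHy IHy'.
  rewrite -[in LHS](epsr c) -H -multR1 -[tens x 1]R1K -(can1_mull hDelta) can1K.
  by rewrite mult_mull he1 -E1 -scalerAr mulr1 linearZ /= mulrC.
have eps1_1 : eps1 1 = 1.
  apply: scaler1_inj; have := epsl 1.
  by rewrite Delta1 tens1 slice_left_tens scale1r.
(* In a Hopf algebra [R1 (a (x) b) = a_(1) (x) S(a_(2)) b] and
   [R2 (a (x) b) = a S(b_(1)) (x) b_(2)]; applying the counit to the leg free of [S] isolates the
   antipode. *)
have [S SE] : exists S : {linear A -> A},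
    S =1 fun a => slice_left eps1 (R1 (tens a 1)).
  by apply: exists_linear => c a b; rewrite linearPl !linearP.
have [S2 S2E] : exists S : {linear A -> A},
    S =1 fun a => slice_right eps1 (R2 (tens 1 a)).
  by apply: exists_linear => c a b; rewrite linearPr !linearP.
have Sl a : mult (tmap S idfun (Delta a)) = (eps1 a)%:A.
  have H x : mult (tmap S idfun x) = slice_left eps1 (R1 x).
    elim/tensor_ind: x => [u v|x y IHx IHy]; last by rewrite !raddfD /= IHx IHy.
    rewrite tmap_tens mult_tens SE -slice_left_mulr -R1_mulr tensM.
    by rewrite mulr1 mul1r.
  by rewrite H -D1 can1K slice_left_tens.
have S2r a : mult (tmap idfun S2 (Delta a)) = (eps1 a)%:A.
  have H x : mult (tmap idfun S2 x) = slice_right eps1 (R2 x).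
    elim/tensor_ind: x => [u v|x y IHx IHy]; last by rewrite !raddfD /= IHx IHy.
    rewrite tmap_tens mult_tens S2E -slice_right_mull -R2_mull tensM.
    by rewrite mulr1 mul1r.
  by rewrite H -D2 can2K slice_right_tens.
have SS2 := convolution_inverse_unique hDelta epsl epsr Sl S2r.
have Sr a : mult (tmap idfun S (Delta a)) = (eps1 a)%:A.
  by rewrite -S2r !mult_tmapE; apply: eq_bigr => p _; rewrite SS2.
pose eps : {lrmorphism A -> K | *%R} :=
  HB.pack (eps1 : A -> K) (GRing.Linear.on eps1)
  (GRing.isMonoidMorphism.Build A K eps1 (eps1_1, eps1M)).
exists eps, S; split; first by split=> // a; split.
move=> q p.
(* For [y = u (x) v] the argument of [R1] is [can1] of [(u (x) 1) R1 (p (x) 1) (1 (x) v)]. Taking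
   [y = R1 (q (x) 1)] then gives [S (q p) = S p S q]. *)
have SM y : slice_left eps1 (R1 (can1 Delta y * tens p 1))
    = S p * slice_left eps1 y.
  elim/tensor_ind: y => [u v|y y' IHy IHy']; last first.
    by rewrite !raddfD /= mulrDl mulrDr !raddfD /= IHy IHy'.
  rewrite can1_tens -mulrA tensM mul1r mulr1.
  have -> : tens p v = can1 Delta (R1 (tens p 1) * tens 1 v).
    by rewrite can1_mulr R1K tensM mulr1 mul1r.
  rewrite -(can1_mull hDelta) can1K mulrA slice_left_mul3 //.
  by rewrite slice_left_tens -SE -scalerAl scalerAr.
by rewrite [S q]SE -SM R1K tensM mulr1 SE.
Qed.

End HopfOfInverses.

(** * Bijectivity of the canonical maps from faithful integrals *)

Section LarsonSweedler.
Variables (K : fieldType) (A : algType K) (Delta : {linear A -> tensor A A}).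
Variables (phi psi : {scalar A}).
Hypothesis hDelta : coproduct Delta.
Hypothesis hphi : left_integral Delta phi.
Hypothesis hpsi : right_integral Delta psi.
Hypothesis phi_faithful : left_faithful phi.
Hypothesis psi_faithful : right_faithful psi.

Lemma can1_inj : injective (can1 Delta).
Proof.
move=> x y /eqP; rewrite -subr_eq0 -raddfB /= => /eqP xy0.
apply/eqP; rewrite -subr_eq0; apply/eqP.
apply: (@slice_left_eq0 _ _ _ _ (fun c => psi \o (c \*o idfun))) => [u|c].
  exact: psi_faithful.
have := slice_left_can1 hDelta c (x - y) hpsi.
by rewrite xy0 mulr0 raddf0 => <-.
Qed.

Lemma can2_inj : injective (can2 Delta).
Proof.
move=> x y /eqP; rewrite -subr_eq0 -raddfB /= => /eqP xy0.
apply/eqP; rewrite -subr_eq0; apply/eqP.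
apply: (@slice_right_eq0 _ _ _ _ (fun c => phi \o (c \o* idfun))) => [u|c].
  exact: phi_faithful.
have := slice_right_can2 hDelta c (x - y) hphi.
by rewrite xy0 mul0r raddf0 => <-.
Qed.

(** The scalar [c] anticipates the counit: for [x = a (x) 1] under [can1], or [1 (x) a] under
    [can2], it becomes the counit of [a]. *)
Definition scalar_preimage (T : {linear tensor A A -> tensor A A}) x : Prop :=
  exists y c, T y = x /\ mult y = c%:A.

Lemma scalar_preimage_submodule (T : {linear tensor A A -> tensor A A})
    (f : A -> tensor A A) :
  linear f -> submodule (fun u => scalar_preimage T (f u)).
Proof.
move=> hf; have f0 : f 0 = 0.
  by have := hf (-1) 0 0; rewrite scaler0 addr0 scaleN1r addNr.
split; first by exists 0, 0; rewrite !raddf0 f0 scale0r.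
move=> c u v [y [d [yE my]]] [y' [d' [yE' my']]].
exists (c *: y + y'), (c * d + d').
by rewrite hf !linearP /= yE yE' my my' scalerDl scalerA.
Qed.

Lemma scalar_preimage_can a :
  scalar_preimage (can1 Delta) (tens a 1) /\
  scalar_preimage (can2 Delta) (tens 1 a).
Proof.
set P := fun u => scalar_preimage (can1 Delta) (tens u 1).
set Q := fun u => scalar_preimage (can2 Delta) (tens 1 u).
have hP : submodule P := scalar_preimage_submodule _ (linearPl (@tens K A A) 1).
have hQ : submodule Q := scalar_preimage_submodule _ (linearPr (@tens K A A) 1).
have DE b := tensor_seqK (Delta b).
(* Left faithfulness of [phi] moves the first legs of [Delta a] into [P]; right faithfulness of
   [psi] then moves the second legs into [Q] while keeping the first in [P]. *)
have [v|b|s1 [s1E s1P]] := @sum_tens_leg1 _ _ _ _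
    (fun b => phi \o (b \o* idfun)) P (tensor_seq (Delta a)) _ hP.
- exact: phi_faithful.
- rewrite DE; have [y yE my] := can1_slice_right hDelta a b hphi.
  by exists y, (phi (a * b)).
have [u|c|s [sE sPQ]] := @sum_tens_leg2 _ _ _ _
    (fun c => psi \o (c \*o idfun)) P Q s1 _ hP hQ s1P.
- exact: psi_faithful.
- rewrite s1E DE; have [y yE my] := can2_slice_left hDelta c a hpsi.
  by exists y, (psi (c * a)).
have {s1E sE} sE : sum_tens s = Delta a by rewrite sE s1E DE.
have [x [xE Qx]] : exists x, can1 Delta x = sum_tens s /\ Q (mult x).
  elim: s sPQ {sE} => [|[u v] s IHs] sPQ.
    exists 0; split; first by rewrite /sum_tens big_nil raddf0.
    by rewrite raddf0; exact: hQ.1.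
  have [|x [xE Qx]] := IHs.
    by move=> p ps; apply: sPQ; rewrite inE ps orbT.
  have [[y [c [yE my]]] Qv] := sPQ _ (mem_head _ _).
  exists (y * tens 1 v + x); split.
    by rewrite raddfD /= can1_mulr yE xE tensM mulr1 mul1r /sum_tens big_cons.
  by rewrite raddfD /= mult_mulr my -scalerAl mul1r; apply: hQ.2.
have [z [zE Pz]] : exists z, can2 Delta z = sum_tens s /\ P (mult z).
  elim: s sPQ {sE xE} => [|[u v] s IHs] sPQ.
    exists 0; split; first by rewrite /sum_tens big_nil raddf0.
    by rewrite raddf0; exact: hP.1.
  have [|z [zE Pz]] := IHs.
    by move=> p ps; apply: sPQ; rewrite inE ps orbT.
  have [Pu [y [c [yE my]]]] := sPQ _ (mem_head _ _).
  exists (tens u 1 * y + z); split.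
    by rewrite raddfD /= can2_mull yE zE tensM mulr1 mul1r /sum_tens big_cons.
  by rewrite raddfD /= mult_mull my -scalerAr mulr1; apply: hP.2.
have D1 : can1 Delta (tens a 1) = Delta a by rewrite can1_tens -tens1 mulr1.
have D2 : can2 Delta (tens 1 a) = Delta a by rewrite can2_tens -tens1 mul1r.
(* The conclusions cross over: the preimage under [can1] has its product in [Q], the one under
   [can2] in [P], and injectivity shows that both products are [a]. *)
have xa : x = tens a 1 by apply: can1_inj; rewrite xE D1.
have za : z = tens 1 a by apply: can2_inj; rewrite zE D2.
have mx : mult x = a by rewrite xa mult_tens mulr1.
have mz : mult z = a by rewrite za mult_tens mul1r.
by split; [rewrite -mz; exact: Pz|rewrite -mx; exact: Qx].
Qed.

Lemma hopf_of_integrals :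
  exists eps S, hopf_structure Delta eps S /\ forall a b, S (a * b) = S b * S a.
Proof.
(* One-sided linearity extends the preimages of [u (x) 1] and [1 (x) v] to all tensors. *)
have surj1 x : exists y, can1 Delta y = x.
  elim/tensor_ind: x => [u v|x x' [y <-] [y' <-]]; last first.
    by exists (y + y'); rewrite raddfD.
  have [[y [c [yE _]]] _] := scalar_preimage_can u.
  by exists (y * tens 1 v); rewrite can1_mulr yE tensM mulr1 mul1r.
have surj2 x : exists y, can2 Delta y = x.
  elim/tensor_ind: x => [u v|x x' [y <-] [y' <-]]; last first.
    by exists (y + y'); rewrite raddfD.
  have [_ [y [c [yE _]]]] := scalar_preimage_can v.
  by exists (tens u 1 * y); rewrite can2_mull yE tensM mulr1 mul1r.
have [r1 r1K] := choice surj1; have [r2 r2K] := choice surj2.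
have [R1 R1E] : exists R : {linear tensor A A -> tensor A A}, R =1 r1.
  by apply: exists_linear => c x y; apply: can1_inj; rewrite linearP /= !r1K.
have [R2 R2E] : exists R : {linear tensor A A -> tensor A A}, R =1 r2.
  by apply: exists_linear => c x y; apply: can2_inj; rewrite linearP /= !r2K.
have R1K : cancel R1 (can1 Delta) by move=> x; rewrite R1E r1K.
have R2K : cancel R2 (can2 Delta) by move=> x; rewrite R2E r2K.
have can1K := inj_can_sym R1K can1_inj; have can2K := inj_can_sym R2K can2_inj.
apply: (hopf_of_inverses hDelta R1K can1K R2K can2K) => a.
  by have [[y [c [<- my]]] _] := scalar_preimage_can a; exists c; rewrite can1K.
by have [_ [y [c [<- my]]]] := scalar_preimage_can a; exists c; rewrite can2K.
Qed.

End LarsonSweedler.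

(** * The opposite algebra and its tensor square *)

Section OppositeAlgebra.
Variables (K : comNzRingType) (A : algType K).

(* Copying the scaling makes tensor A^c A^c convertible to tensor A A. *)
HB.instance Definition _ := GRing.Lmodule.copy A^c A.

(* Without the cast on the scaled factor, the product would be that of A. *)
Fact converse_scaleAl (c : K) (a b : A^c) : c *: (a * b) = (c *: a : A^c) * b.
Proof. exact: (@scalerAr K A c b a). Qed.

HB.instance Definition _ :=
  GRing.Lmodule_isLalgebra.Build K A^c converse_scaleAl.

Fact converse_scaleAr (c : K) (a b : A^c) : c *: (a * b) = a * (c *: b : A^c).
Proof. exact: (@scalerAl K A c b a). Qed.

HB.instance Definition _ :=
  GRing.Lalgebra_isAlgebra.Build K A^c converse_scaleAr.

Lemma converse_tensorM (x y : tensor A A) :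
  (x : tensor A^c A^c) * (y : tensor A^c A^c) = y * x :> tensor A A.
Proof.
elim/tensor_ind: x => [a b|x x' IHx IHx']; last first.
  by rewrite mulrDr -IHx -IHx'; exact: (@mulrDl (tensor A^c A^c)).
elim/tensor_ind: y => [a' b'|y y' IHy IHy']; last first.
  by rewrite mulrDl -IHy -IHy'; exact: (@mulrDr (tensor A^c A^c)).
rewrite tensM; exact: (@tensM K A^c A^c).
Qed.

End OppositeAlgebra.

(** * Invertibility of the antipode *)

Section InvertibleAntipode.
Variables (K : fieldType) (A : algType K) (Delta : {linear A -> tensor A A}).
Local Notation sw a := (tensor_seq (Delta a)).

(** Applying the antimultiplicative [S] to the hypothesis on [S'] makes [S \o S'] a right
    convolution inverse of [S]; the identity is a left one, so they agree. *)
Lemma antipodeK (eps : {lrmorphism A -> K | *%R}) (S S' : {linear A -> A}) :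
    hopf_structure Delta eps S -> (forall a b, S (a * b) = S b * S a) ->
    (forall a, \sum_(p <- sw a) S' p.2 * p.1 = (eps a)%:A) ->
  cancel S' S.
Proof.
case=> hDelta Delta1 heps hS SM hS' a.
have S1 : S 1 = 1.
  have [+ _] := hS 1; rewrite Delta1 tens1 tmap_tens mult_tens mulr1.
  by rewrite rmorph1 scale1r.
symmetry; apply: (convolution_inverse_unique hDelta
  (f := idfun) (g := S) (h := S \o S') (eps := eps)) => {}a.
- by have [] := heps a.
- by have [] := heps a.
- by have [] := hS a.
rewrite mult_tmapE /=; under eq_bigr => p _ do rewrite -SM.
by rewrite -raddf_sum hS' /= linearZ /= S1.
Qed.

End InvertibleAntipode.

Section ConverseHopf.
Variables (K : fieldType) (A : algType K) (Delta : {linear A -> tensor A A}).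

Let Deltac : {linear A^c -> tensor A^c A^c} := Delta.

Lemma coproduct_converse : coproduct Delta -> coproduct Deltac.
Proof.
case=> DM DA; split; last exact: DA.
move=> a b; rewrite [RHS]converse_tensorM; exact: (DM b a).
Qed.

Lemma bijective_antipode (phi psi : {scalar A}) :
    coproduct Delta -> left_integral Delta phi -> right_integral Delta psi ->
    faithful phi -> faithful psi ->
  hopf_algebra_with_invertible_antipode Delta.
Proof.
move=> hDelta hphi hpsi [lphi rphi] [lpsi rpsi].
have [eps [S [hS SM]]] := hopf_of_integrals hDelta hphi hpsi lphi rpsi.
have hphic : left_integral Deltac (phi : {scalar A^c}) := hphi.
have hpsic : right_integral Deltac (psi : {scalar A^c}) := hpsi.
(* Reversing the product exchanges left and right faithfulness, so the remaining halves of the two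
   assumptions are used here. *)
have [epsc [Sc [hSc ScM]]] :=
  hopf_of_integrals (coproduct_converse hDelta) hphic hpsic rphi lpsi.
have [_ _ heps aS] := hS; have [_ _ hepsc aSc] := hSc.
(* The counit axioms involve only [Delta], which both algebras share. *)
have eE : eps =1 epsc.
  apply: (@left_right_counit _ _ Delta eps epsc) => a.
    by have [] := heps a.
  by have [] := hepsc a.
(* The right antipode axiom of each algebra, read with the opposite product, is the hypothesis of
   [antipodeK] for the other. *)
exists eps, S; split=> //; exists Sc.
  apply: (@antipodeK _ A^c Deltac epsc Sc S hSc ScM) => a.
  have [_] := aS a; rewrite mult_tmapE -eE; exact.
apply: (antipodeK hS SM) => a.
have [_] := aSc a; rewrite mult_tmapE eE; exact.
Qed.

End ConverseHopf.

Theorem corollary2p12 (R : realType) (A : algType R[i])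
    (Delta : {linear A -> tensor A A}) (hDelta : coproduct Delta)
    (phi psi : {scalar A})
    (hphi : left_integral Delta phi) (hpsi : right_integral Delta psi)
    (phi_faithful : left_faithful phi) (psi_faithful : right_faithful psi) :
  hopf_algebra Delta /\
  (faithful phi -> faithful psi ->
   hopf_algebra_with_invertible_antipode Delta).
Proof.
split; last exact: bijective_antipode.
have [eps [S [hS _]]] :=
  hopf_of_integrals hDelta hphi hpsi phi_faithful psi_faithful.
by exists eps, S.
Qed.
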